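(* Let $n > 2$ be an integer, and let $T_n = \{ a\,(1,0) + b\,(\tfrac12, \tfrac{\sqrt3}{2}) : a, b \in \mathbb{Z}_{\ge 0},\ a + b \le n-1 \} \subset \mathbb{R}^2$ be the triangular region of the regular triangular grid with $n$ vertices on each side. Then there are exactly $\binom{n+2}{4}$ equilateral triangles whose three vertices all lie in $T_n$.
   Context: The set $T_n$ consists of $n(n+1)/2$ points of the regular triangular lattice in the Euclidean plane, arranged in an equilateral triangle with $n$ points on each side. An equilateral triangle with vertices in $T_n$ means a (non-degenerate) equilateral triangle, identified with its unordered set of three distinct vertices, i.e. a three-element subset $\{P,Q,R\} \subseteq T_n$ whose three pairwise Euclidean distances are equal. Triangles of every size and every orientation are counted; the sides need not be parallel to the grid lines. Congruent triangles in different positions are counted as different. *)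

(* Defs.v *)
From HB Require Import structures.
From mathcomp Require Import all_boot all_order all_algebra.
From mathcomp Require Import boolp classical_sets functions cardinality reals.

Set Implicit Arguments.
Unset Strict Implicit.
Unset Printing Implicit Defensive.

Import Order.TTheory GRing.Theory Num.Theory.
Local Open Scope classical_set_scope.
Local Open Scope ring_scope.

(* The norm that the libraries attach to products is the sup norm, whence this
   explicit definition of the Euclidean distance. *)
Definition eucl_dist (R : realType) (P Q : R * R) : R :=
  Num.sqrt ((P.1 - Q.1) ^+ 2 + (P.2 - Q.2) ^+ 2).

Definition tri_grid (R : realType) (n : nat) : set (R * R) :=
  [set P | exists a b : nat, (a + b <= n - 1)%N /\
     P = (1, 0) *+ a + (1 / 2, Num.sqrt 3 / 2) *+ b].
Arguments tri_grid R n : clear implicits.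

(* A triangle is identified with its unordered set of vertices. *)
Definition equilateral_triangle (R : realType) (T : set (R * R)) : Prop :=
  exists A B C : R * R,
    [/\ T = [set A; B; C],
        [/\ A != B, B != C & C != A],
        eucl_dist A B = eucl_dist B C &
        eucl_dist B C = eucl_dist C A].

(* Main.v *)
Require Import Defs.
From mathcomp Require Import all_boot all_order all_algebra.
From mathcomp Require Import boolp classical_sets functions cardinality reals.
From mathcomp Require Import zify ring.

Set Implicit Arguments.
Unset Strict Implicit.
Unset Printing Implicit Defensive.

Import Order.TTheory GRing.Theory Num.Theory.
Local Open Scope classical_set_scope.
Local Open Scope ring_scope.
Local Open Scope card_scope.

(** An upward triangle is one whose sides are parallel to the grid lines and
    which points the same way as the region itself.  Every equilateral triangle
    with vertices in the grid is inscribed in exactly one upward triangle, with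
    one vertex on each side, all three sides being cut in the same ratio.  If
    the upward triangle has lower-left corner (a, b) and side t + u + 1, and its
    sides are cut into t and u + 1, then the inscribed triangle has vertices
    (a + t, b), (a + u + 1, b + t), (a, b + u + 1) in grid coordinates.  It lies
    in the region exactly when the upward triangle does, that is, when
    a + b + t + u <= n - 2.  So equilateral triangles correspond to quadruples
    of natural numbers of sum at most n - 2, and there are 'C(n + 2, 4) of
    these.

    That every equilateral triangle arises this way rests on two facts.  First,
    the third vertex is the image of the second under a rotation by 60 degrees,
    in one sense or the other, about the first ([equilateral_direct]);
    exchanging two vertices makes the sense counterclockwise.  In grid
    coordinates this rotation is (x, y) |-> (- y, x + y).  Secondly, the three
    sides of a counterclockwise triangle are directed at angles differing by
    120 degrees,
    so exactly one of them is directed into the 120 degree sector y >= 0,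
    x + y > 0; the numbering of the vertices that starts with this side is
    the one above ([direct_sector], [direct_quad]). *)

(** * Coordinates *)

Definition grid_point (R : realType) (p : nat * nat) : R * R :=
  (1, 0) *+ p.1 + (1 / 2, Num.sqrt 3 / 2) *+ p.2.

(** The squared Euclidean distance of two grid points, which is an integer: the
    two basis vectors have length 1 and inner product 1/2. *)
Definition sqdist (p q : nat * nat) : int :=
  let x := p.1%:Z - q.1%:Z in let y := p.2%:Z - q.2%:Z in
  x ^+ 2 + x * y + y ^+ 2.

(** The vector [r - p] is [q - p] rotated by 60 degrees counterclockwise, that
    is (- y, x + y) if [q - p] is (x, y); the terms are moved so that only
    additions of natural numbers occur. *)
Definition direct (p q r : nat * nat) : Prop :=
  (r.1 + q.2 = p.1 + p.2)%N /\ (r.2 + p.1 = q.1 + q.2)%N.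

(** A quadruple (a, b, t, u) stands for the triangle inscribed in the upward
    triangle with corner (a, b) and side t + u + 1, cutting its sides into t
    and u + 1.  The successor makes the side positive and leaves t = 0, but not
    u + 1 = 0, for the upward triangle itself, which would otherwise be
    represented twice. *)
Definition quad : Type := nat * nat * nat * nat.

Definition quad_sum (c : quad) : nat :=
  let: (a, b, t, u) := c in (a + b + t + u)%N.

Definition tri_vertex1 (c : quad) : nat * nat :=
  let: (a, b, t, u) := c in (a + t, b)%N.
Definition tri_vertex2 (c : quad) : nat * nat :=
  let: (a, b, t, u) := c in (a + u.+1, b + t)%N.
Definition tri_vertex3 (c : quad) : nat * nat :=
  let: (a, b, t, u) := c in (a, b + u.+1)%N.

Definition quad_vertices (c : quad) : set (nat * nat) :=
  [set tri_vertex1 c; tri_vertex2 c; tri_vertex3 c].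

Lemma grid_pointE (R : realType) (p : nat * nat) :
  grid_point R p = (p.1%:R + p.2%:R / 2, p.2%:R * (Num.sqrt 3 / 2)).
Proof.
have pairMn (x y : R) k : (x, y) *+ k = (x *+ k, y *+ k).
  elim: k => [|k IH]; first by rewrite !mulr0n.
  by rewrite !mulrS IH.
rewrite /grid_point !pairMn; congr (_, _) => /=;
  last by rewrite mul0rn add0r mulr_natl.
by rewrite -[_ *+ p.2]mulr_natl mul1r.
Qed.

Lemma sqdist_ge0 (p q : nat * nat) : 0 <= sqdist p q.
Proof.
rewrite /sqdist; set x : int := _ - _; set y : int := _ - _.
(* Completing the square in 4 (x^2 + x y + y^2). *)
suff: 0 <= (2 * x + y) ^+ 2 + 3 * y ^+ 2 by lia.
by apply: addr_ge0; [exact: sqr_ge0 | apply: mulr_ge0 => //; exact: sqr_ge0].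
Qed.

Lemma eucl_dist_grid (R : realType) (p q : nat * nat) :
  eucl_dist (grid_point R p) (grid_point R q) = Num.sqrt (sqdist p q)%:~R.
Proof.
rewrite /eucl_dist !grid_pointE /=; congr Num.sqrt.
rewrite -mulrBl exprMn expr_div_n sqr_sqrtr ?ler0n //.
rewrite /sqdist !(rmorphD, rmorphM, rmorphXn, rmorphB) /=.
by field.
Qed.

(** Square roots are injective on nonnegative numbers, so equality of lengths
    becomes an equation between integers. *)
Lemma eucl_dist_grid_eq (R : realType) (p q p' q' : nat * nat) :
  eucl_dist (grid_point R p) (grid_point R q) =
    eucl_dist (grid_point R p') (grid_point R q') <-> sqdist p q = sqdist p' q'.
Proof.
rewrite !eucl_dist_grid; split=> [/eqP|->//].
by rewrite eqr_sqrt ?ler0z ?sqdist_ge0// eqr_int => /eqP.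
Qed.

Lemma grid_point_inj (R : realType) : injective (grid_point R).
Proof.
move=> [a b] [c d]; rewrite !grid_pointE => -[/= e1 /mulIf e2].
have sqrt3 : Num.sqrt 3 / 2 != 0 :> R.
  by rewrite mulf_neq0 ?invr_eq0 ?pnatr_eq0 // gt_eqF ?sqrtr_gt0 ?ltr0n.
move: (e2 sqrt3) e1 => ebd; rewrite ebd => /addIr /eqP.
by move/eqP: ebd; rewrite !eqr_nat => /eqP -> /eqP ->.
Qed.

(** * Equilateral triangles of the grid *)

Lemma direct_rot (p q r : nat * nat) : direct p q r -> direct q r p.
Proof. rewrite /direct; lia. Qed.

Lemma norm_eq0 (x y : int) : x ^+ 2 + x * y + y ^+ 2 = 0 -> x = 0 /\ y = 0.
Proof.
move=> N0.
have e : (2 * x + y) ^+ 2 + 3 * y ^+ 2 = 4 * (x ^+ 2 + x * y + y ^+ 2) by ring.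
have h1 := sqr_ge0 (2 * x + y); have h2 := sqr_ge0 y.
rewrite N0 in e.
have /eqP : y ^+ 2 = 0 by move: h1 h2 e; clear; lia.
rewrite sqrf_eq0 => /eqP y0; move: N0.
rewrite y0 mulr0 expr0n /= !addr0 => /eqP; rewrite sqrf_eq0 => /eqP x0.
by rewrite x0.
Qed.

(** The vectors e = (x, y), f = (z, w) and f - e have the same squared length D
    in grid coordinates.  Polarization gives 2 <e, f> = D, and the identity
    4 N(e) N(f) = (2 <e, f>)^2 + 3 det(e, f)^2 then gives det(e, f) = D or - D.
    For either sign, these are two linear equations for f, of determinant
    - 2 D, solved by one of the two rotated copies of e. *)
Lemma equal_norm_rotation (D x y z w : int) : D != 0 ->
    x ^+ 2 + x * y + y ^+ 2 = D -> z ^+ 2 + z * w + w ^+ 2 = D ->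
    (z - x) ^+ 2 + (z - x) * (w - y) + (w - y) ^+ 2 = D ->
  (z = - y /\ w = x + y) \/ (z = x + y /\ w = - x).
Proof.
move=> D0 Nv Nw Nvw.
have polar : (2 * x + y) * z + (x + 2 * y) * w = D.
  transitivity (x ^+ 2 + x * y + y ^+ 2 + (z ^+ 2 + z * w + w ^+ 2)
    - ((z - x) ^+ 2 + (z - x) * (w - y) + (w - y) ^+ 2)); first by ring.
  by rewrite Nv Nw Nvw addrK.
have : (x * w - y * z) ^+ 2 == D ^+ 2.
  have : ((2 * x + y) * z + (x + 2 * y) * w) ^+ 2 + 3 * (x * w - y * z) ^+ 2
      = 4 * ((x ^+ 2 + x * y + y ^+ 2) * (z ^+ 2 + z * w + w ^+ 2)) by ring.
  rewrite polar Nv Nw -expr2; move: (D ^+ 2) (_ ^+ 2); clear; lia.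
(* Cramer's rule for the linear system satisfied by z and w. *)
have ez : x * ((2 * x + y) * z + (x + 2 * y) * w)
    - (x + 2 * y) * (x * w - y * z) = (x ^+ 2 + x * y + y ^+ 2) * (2 * z).
  by ring.
have ew : y * ((2 * x + y) * z + (x + 2 * y) * w)
    + (2 * x + y) * (x * w - y * z) = (x ^+ 2 + x * y + y ^+ 2) * (2 * w).
  by ring.
rewrite polar Nv in ez ew.
rewrite eqf_sqr => /orP[] /eqP det; rewrite det in ez ew; [left|right].
- have /(mulfI D0) : D * (2 * z) = D * (- (2 * y)) by rewrite -ez; ring.
  have /(mulfI D0) : D * (2 * w) = D * (2 * (x + y)) by rewrite -ew; ring.
  by clear; lia.
- have /(mulfI D0) : D * (2 * z) = D * (2 * (x + y)) by rewrite -ez; ring.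
  have /(mulfI D0) : D * (2 * w) = D * (- (2 * x)) by rewrite -ew; ring.
  by clear; lia.
Qed.

Lemma equilateral_direct (p q r : nat * nat) : p != q ->
    sqdist p q = sqdist q r -> sqdist q r = sqdist r p ->
  direct p q r \/ direct p r q.
Proof.
case: p q r => [p1 p2] [q1 q2] [r1 r2] neq e1 e2.
have := @equal_norm_rotation (sqdist (p1, p2) (q1, q2))
  (q1%:Z - p1%:Z) (q2%:Z - p2%:Z) (r1%:Z - p1%:Z) (r2%:Z - p2%:Z).
rewrite /direct /=; case; try by clear; lia.
- by apply: contra neq => /eqP /norm_eq0 /= []; clear; rewrite xpair_eqE; lia.
- by rewrite /sqdist /=; ring.
- by rewrite e1 e2 /sqdist /=; ring.
- by rewrite e1 /sqdist /=; ring.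
Qed.

(** The three cases say that [q - p], [r - q] or [p - r] lies in the sector
    y >= 0, x + y > 0.  These vectors differ by rotations of 120 degrees,
    and the three rotated copies of the sector cover the plane without the
    origin. *)
Lemma direct_sector (p q r : nat * nat) : direct p q r -> p != q ->
  [\/ (p.2 <= q.2)%N /\ (p.2 < r.2)%N, (q.2 <= r.2)%N /\ (q.2 < p.2)%N |
      (r.2 <= p.2)%N /\ (r.2 < q.2)%N].
Proof.
case: p q r => [p1 p2] [q1 q2] [r1 r2]; rewrite xpair_eqE /direct /= => d neq.
have [py|py] := leqP p2 q2; have [pry|pry] := ltnP p2 r2.
- by apply: Or31.
- by apply: Or33; lia.
- by have [] := leqP q2 r2 => h; [apply: Or32|apply: Or33]; lia.
- by have [] := leqP q2 r2 => h; [apply: Or32|apply: Or33]; lia.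
Qed.

(** The sector condition makes the differences defining [t] and [u] nonnegative,
    so truncated subtraction is exact here. *)
Lemma direct_quad (p q r : nat * nat) :
    direct p q r -> (p.2 <= q.2)%N -> (p.2 < r.2)%N ->
  exists c : quad, [set p; q; r] = quad_vertices c.
Proof.
case: p q r => [p1 p2] [q1 q2] [r1 r2]; rewrite /direct /= => -[h1 h2] h3 h4.
exists (r1, p2, q2 - p2, r2 - p2.+1)%N.
by rewrite /quad_vertices /=; congr [set (_, _); (_, _); (_, _)]; lia.
Qed.

Lemma set3_rot (T : Type) (x y z : T) : [set x; y; z] = [set y; z; x].
Proof. by rewrite -setUA setUC. Qed.

Lemma direct_inscribed (p q r : nat * nat) : direct p q r -> p != q ->
  exists c : quad, [set p; q; r] = quad_vertices c.
Proof.
move=> dpqr neq; case: (direct_sector dpqr neq) => -[h1 h2].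
- exact: direct_quad.
- by rewrite set3_rot; apply: direct_quad => //; exact: direct_rot.
- by rewrite -set3_rot; apply: direct_quad => //; do 2 apply: direct_rot.
Qed.

Lemma quad_direct (c : quad) :
  direct (tri_vertex1 c) (tri_vertex2 c) (tri_vertex3 c).
Proof. case: c => [[[a b] t] u]; rewrite /direct /=; lia. Qed.

Lemma direct_equilateral (p q r : nat * nat) : direct p q r ->
  sqdist p q = sqdist q r /\ sqdist q r = sqdist r p.
Proof.
case: p q r => [p1 p2] [q1 q2] [r1 r2]; rewrite /direct /sqdist /= => -[h1 h2].
have -> : r1%:Z = p1%:Z + p2%:Z - q2%:Z by lia.
have -> : r2%:Z = q1%:Z + q2%:Z - p1%:Z by lia.
split; ring.
Qed.

(** The least abscissa and ordinate of the vertices are [a] and [b].  Vertices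
    of one triangle can only match those of the other in one of six orders: the
    odd ones reverse the orientation and the two nontrivial cyclic ones leave
    the sector, so only the identity is consistent. *)
Lemma quad_vertices_inj : injective quad_vertices.
Proof.
move=> [[[a b] t] u] [[[a' b'] t'] u'] e.
have sub x : quad_vertices (a, b, t, u) x -> quad_vertices (a', b', t', u') x.
  by rewrite e.
have: quad_vertices (a', b', t', u') (a + t, b)%N by apply: sub; left; left.
have: quad_vertices (a', b', t', u') (a + u.+1, b + t)%N.
  by apply: sub; left; right.
have: quad_vertices (a', b', t', u') (a, b + u.+1)%N by apply: sub; right.
rewrite /quad_vertices /= => -[[]|] [] e1 e2 [[]|] [] e3 e4 [[]|] [] e5 e6;
  do ?congr (_, _); lia.
Qed.

(** * Counting quadruples *)

Lemma card_finset (T : finType) (A : {set T}) : [set` A] #= `I_#|A|.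
Proof.
have -> : [set` A] = [set (enum_val i : T) | i in [set: 'I_#|A|]].
  apply/seteqP; split=> [x xA|_ [i _ <-]]; last exact: enum_valP.
  by exists (enum_rank_in xA x); rewrite // enum_rankK_in.
apply: card_eq_trans (card_esym card_II); apply: inj_card_eq => i j _ _.
exact: enum_val_inj.
Qed.

(** The entries of a quadruple of sum at most [N] are themselves at most [N], so
    such quadruples are tuples over the ordinals below [N.+1], whose number is
    known. *)
Lemma card_quads (N : nat) :
  [set c | quad_sum c <= N]%N #= `I_('C(4 + N, 4)%N).
Proof.
rewrite -card_partial_ord_partitions.
set W := finset _.
pose code (w : 4.-tuple 'I_N.+1) : quad :=
  (tnth w (inord 0) : nat, tnth w (inord 1) : nat,
   tnth w (inord 2) : nat, tnth w (inord 3) : nat).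
have sumE (w : 4.-tuple 'I_N.+1) : (\sum_(i <- w) i)%N = quad_sum (code w).
  rewrite big_tuple !big_ord_recl big_ord0 /= addn0 !addnA.
  by do ![congr (_ + _)%N | congr nat_of_ord | congr tnth];
    apply: val_inj; rewrite /= inordK.
have code_inj : injective code.
  move=> w w' [] e0 e1 e2 e3; apply: eq_from_tnth => i; apply: val_inj.
  rewrite -(inord_val i).
  by case: i => -[|[|[|[|//]]]] /=.
have -> : [set c | quad_sum c <= N]%N = [set code w | w in [set` W]].
  apply/seteqP; split=> [[[[a b] t] u] /= le|c [w] /= + <-]; last first.
    by rewrite inE sumE.
  have codeE : code [tuple inord a; inord b; inord t; inord u] = (a, b, t, u).
    by rewrite /code !(tnth_nth ord0) /= !inordK //; move: le; clear; lia.
  exists [tuple inord a; inord b; inord t; inord u] => //.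
  by rewrite inE sumE codeE.
apply: card_eq_trans (card_finset W); apply: inj_card_eq => w w' _ _.
exact: code_inj.
Qed.

(** * The correspondence *)

(** The sum of the coordinates is largest at the second vertex, where it is
    a + b + t + u + 1. *)
Lemma quad_vertices_grid (n : nat) (c : quad) : (1 < n)%N ->
  quad_vertices c `<=` [set p | p.1 + p.2 <= n - 1]%N <->
  (quad_sum c <= n - 2)%N.
Proof.
case: c => [[[a b] t] u] n_gt1; split=> [sub | le p].
  have /sub /= : quad_vertices (a, b, t, u) (a + u.+1, b + t)%N by left; right.
  lia.
by move=> [[]|] -> /=; move: le => /=; lia.
Qed.

Lemma quad_triangle_equilateral (R : realType) (c : quad) :
  equilateral_triangle (grid_point R @` quad_vertices c).
Proof.
exists (grid_point R (tri_vertex1 c)), (grid_point R (tri_vertex2 c)),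
  (grid_point R (tri_vertex3 c)).
have [e1 e2] := direct_equilateral (quad_direct c).
split; try exact/eucl_dist_grid_eq.
  by rewrite /quad_vertices !image_setU !image_set1.
rewrite !(inj_eq (@grid_point_inj R)).
by case: c {e1 e2} => [[[a b] t] u] /=; rewrite !xpair_eqE; split; lia.
Qed.

Lemma equilateral_quad (R : realType) (T : set (R * R)) :
    T `<=` range (grid_point R) -> equilateral_triangle T ->
  exists c, T = grid_point R @` quad_vertices c.
Proof.
move=> Tgrid [A [B [C [defT]]]].
have /Tgrid [p _ eA] : T A by rewrite defT; left; left.
have /Tgrid [q _ eB] : T B by rewrite defT; left; right.
have /Tgrid [r _ eC] : T C by rewrite defT; right.
subst A B C.
rewrite !(inj_eq (@grid_point_inj R)) => -[pq _ rp].
move=> /eucl_dist_grid_eq e1 /eucl_dist_grid_eq e2.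
have imageE : [set grid_point R p; grid_point R q; grid_point R r]
    = grid_point R @` [set p; q; r] by rewrite !image_setU !image_set1.
rewrite defT imageE; have [d|d] := equilateral_direct pq e1 e2.
  by have [c ->] := direct_inscribed d pq; exists c.
have pr : p != r by rewrite eq_sym.
by have [c defc] := direct_inscribed d pr; exists c; rewrite setUAC defc.
Qed.

Lemma tri_gridE (R : realType) (n : nat) :
  tri_grid R n = grid_point R @` [set p | p.1 + p.2 <= n - 1]%N.
Proof.
apply/seteqP; split=> [P [a [b [le ->]]]|_ [[a b] /= le <-]].
  by exists (a, b).
by exists a, b.
Qed.

Lemma image_subset_inj (T U : Type) (f : T -> U) (A B : set T) :
  injective f -> f @` A `<=` f @` B <-> A `<=` B.
Proof.
move=> f_inj; split=> [sub x Ax|]; last exact: image_subset.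
by rewrite -(image_inj f_inj); apply: sub; exists x.
Qed.

Lemma image_set_inj (T U : Type) (f : T -> U) :
  injective f -> injective (fun A : set T => f @` A).
Proof.
move=> f_inj A B e.
by apply/seteqP; split; apply/(image_subset_inj _ _ f_inj); rewrite e.
Qed.

Theorem theorem1 (R : realType) (n : nat) (hn : (2 < n)%N) :
  [set T : set (R * R) | T `<=` tri_grid R n /\ equilateral_triangle T]
    #= `I_('C(n + 2, 4)%N).
Proof.
have -> : [set T | T `<=` tri_grid R n /\ equilateral_triangle T] =
    (fun c => grid_point R @` quad_vertices c) @`
      [set c | quad_sum c <= n - 2]%N.
  rewrite tri_gridE; apply/seteqP; split=> [T [Tn Teq]|_ [c le <-]].
    have [|c defT] := equilateral_quad _ Teq.
      by apply: subset_trans Tn _; exact: image_subset.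
    exists c => //; apply/(quad_vertices_grid c (ltnW hn)).
    by apply/(image_subset_inj _ _ (@grid_point_inj R)); rewrite -defT.
  split; last exact: quad_triangle_equilateral.
  by apply: image_subset; apply/(quad_vertices_grid c (ltnW hn)).
have -> : (n + 2 = 4 + (n - 2))%N by lia.
apply: card_eq_trans (card_quads _); apply: inj_card_eq => c c' _ _ e.
exact/quad_vertices_inj/(image_set_inj (@grid_point_inj R)).
Qed.
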